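(* Let $n\ge 2$. Assume that $D\subsetneq\mathbb{R}^n$ is an unbounded $c$-John domain, and let $0<\tau,s<1$ and $1\le p<\infty$. Then there is a constant $C=C(\tau,n,c,s,p)>0$, depending at most on the indicated parameters, such that the inequality $$|u(x)|\le C\int_D\frac{g(y)}{|x-y|^{n-s}}\,dy=C\,\mathcal{I}_s(\chi_D g)(x)$$ holds whenever $u\in\bigcup_{1\le r<\infty}L^r(D)$ and $x\in D$ is a Lebesgue point of $u$, where $$g(y):=\left(\int_{B(y,\tau\delta_{\partial D}(y))}\frac{|u(y)-u(z)|^p}{|y-z|^{n+sp}}\,dz\right)^{1/p}$$ for every $y\in D$.
   Context: $B(x,r)$ is the open ball in $\mathbb{R}^n$ with center $x$ and radius $r$, $\delta_{\partial D}(y)=\operatorname{dist}(y,\partial D)$, and $\chi_D$ is the characteristic function of $D$ (so $\chi_D g$ is $g$ extended by zero outside $D$). A domain is an open connected set. For $c\ge1$, a domain $D\subsetneq\mathbb{R}^n$, $n\ge2$, is a $c$-John domain if each pair of points $x_1,x_2\in D$ can be joined by a rectifiable arc length parametrized curve $\gamma:[0,\ell]\to D$ (that is, $\gamma(0)=x_1$, $\gamma(\ell)=x_2$) satisfying $\operatorname{dist}(\gamma(t),\partial D)\ge\min\{t,\ell-t\}/c$ for every $t\in[0,\ell]$. For $0<\alpha<n$ and a measurable function $f:\mathbb{R}^n\to[0,\infty]$, the Riesz potential of $f$ is $$\mathcal{I}_\alpha(f)(x)=\int_{\mathbb{R}^n}\frac{f(y)}{|x-y|^{n-\alpha}}\,dy,\qquad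 x\in\mathbb{R}^n.$$ *)

(* Defs.v *)
From HB Require Import structures.
From mathcomp Require Import all_boot all_order all_algebra.
From mathcomp Require Import all_classical all_reals all_analysis.

Set Implicit Arguments.
Unset Strict Implicit.
Unset Printing Implicit Defensive.
Import Order.TTheory GRing.Theory Num.Theory.
Import numFieldNormedType.Exports.

Local Open Scope classical_set_scope.
Local Open Scope ring_scope.

(* Points of R^n are row vectors 'rV[R]_n.  Their library norm is the sup norm;
   it induces the usual topology and the usual bounded sets, so the library's
   [open], [connected], [closure], [bounded_set] are used unchanged, but every
   metric quantity below uses the Euclidean norm [enorm]. *)
Section euclidean.
Context {R : realType} {n : nat}.
Implicit Types (x y a b : 'rV[R]_n) (A D : set 'rV[R]_n).

Definition enorm x : R := Num.sqrt (\sum_(i < n) x ord0 i ^+ 2).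

Definition eball x (r : R) : set 'rV[R]_n := [set y | enorm (x - y) < r].

Definition boundary D : set 'rV[R]_n := closure D `\` interior D.

Definition dist_to x A : R := inf [set enorm (x - a) | a in A].

Definition delta D x : R := dist_to x (boundary D).

(* Product of the half-open intervals ]a_i, b_i]; empty as soon as b_i <= a_i
   for some i, in which case its volume below is 0. *)
Definition box (ab : 'rV[R]_n * 'rV[R]_n) : set 'rV[R]_n :=
  [set x | forall i, ab.1 ord0 i < x ord0 i <= ab.2 ord0 i].

Definition box_volume (ab : 'rV[R]_n * 'rV[R]_n) : \bar R :=
  (\prod_(i < n) Num.max 0 (ab.2 ord0 i - ab.1 ord0 i))%:E.

Lemma box_volume_ge0 ab : (0 <= box_volume ab)%E.
Proof. by rewrite lee_fin prodr_ge0 // => i _; rewrite le_max lexx. Qed.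

Definition box_cover A : set (set ('rV[R]_n * 'rV[R]_n)) :=
  [set S | countable S /\ A `<=` \bigcup_(ab in S) box ab].

Definition lebesgue_outer A : \bar R :=
  ereal_inf [set (\esum_(ab in S) box_volume ab)%E | S in box_cover A].

Lemma lebesgue_outer_ge0 A : (0 <= lebesgue_outer A)%E.
Proof.
apply: le_ereal_inf_tmp => _ [S _ <-].
by apply: esum_ge0 => ab _; exact: box_volume_ge0.
Qed.

Lemma lebesgue_outer0 : lebesgue_outer set0 = 0%E.
Proof.
apply/eqP; rewrite eq_le lebesgue_outer_ge0 andbT.
apply: ereal_inf_lbound; exists set0; last exact: esum_set0.
by split => //; exact: countable0.
Qed.

Lemma le_lebesgue_outer :
  {homo lebesgue_outer : A B / A `<=` B >-> (A <= B)%E}.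
Proof.
move=> A B AB; apply/ereal_inf_le_tmp => _ [S [cS BS] <-].
by exists S => //; split => //; exact: subset_trans BS.
Qed.

Lemma lebesgue_outer_sigma_subadditive : sigma_subadditive lebesgue_outer.
Proof.
move=> A; have [[i ioo]|] := pselect (exists i, lebesgue_outer (A i) = +oo%E).
  rewrite (eseries_pinfty _ _ ioo) ?leey// => k _.
  by rewrite -ltNye (lt_le_trans _ (lebesgue_outer_ge0 _)).
rewrite -forallNE => Aoo.
apply/lee_addgt0Pr => _/posnumP[e].
rewrite (le_trans _ (epsilon_trick _ _ _))//; last first.
  by move=> k; exact: lebesgue_outer_ge0.
pose P k S := box_cover (A k) S /\
  (\esum_(ab in S) box_volume ab <=
     lebesgue_outer (A k) + (e%:num / (2 ^ k.+1)%:R)%:E)%E.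
have [G PG] : {G & forall k, P k (G k)}.
  apply: (@choice _ _ P) => k.
  have fin : lebesgue_outer (A k) \is a fin_num.
    by rewrite ge0_fin_numE ?lebesgue_outer_ge0// ltey; apply/eqP/Aoo.
  have e0 : 0 < e%:num / (2 ^ k.+1)%:R by [].
  have [_ [S AS <-] /ltW lS] := lb_ereal_inf_adherent e0 fin.
  by exists S; split.
apply: (@le_trans _ _ (\esum_(ab in \bigcup_k G k) box_volume ab)%E).
  apply: ereal_inf_lbound; exists (\bigcup_k G k) => //; split.
    by apply: bigcup_countable => // k _; exact: (PG k).1.1.
  by move=> x [k _ /(PG k).1.2[ab Gab abx]]; exists ab => //; exists k.
rewrite seqDU_bigcup_eq esum_bigcupT//; last first.
  by move=> ab; exact: box_volume_ge0.
rewrite -nneseries_esumT; last first.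
  by move=> k; apply: esum_ge0 => ab _; exact: box_volume_ge0.
apply: lee_nneseries => [k _ _|k _].
  by apply: esum_ge0 => ab _; exact: box_volume_ge0.
apply: le_trans (PG k).2; rewrite !(esum_mkcond _ box_volume).
apply: le_esum => ab _; case: ifPn => [|_].
  by move=> /set_mem abG; rewrite mem_set//; exact: subset_seqDU abG.
by case: ifPn => // _; exact: box_volume_ge0.
Qed.

HB.instance Definition _ := isOuterMeasure.Build R 'rV[R]_n lebesgue_outer
  lebesgue_outer0 lebesgue_outer_ge0 le_lebesgue_outer
  lebesgue_outer_sigma_subadditive.

End euclidean.

(* The measurable subsets of R^n are the Lebesgue measurable ones, i.e. the
   Caratheodory measurable sets of the Lebesgue outer measure. *)
HB.instance Definition _ (R : realType) (n : nat) :=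
  Measurable.copy 'rV[R]_n (caratheodory_type (@lebesgue_outer R n)).

Definition leb {R : realType} {n : nat} : set 'rV[R]_n -> \bar R :=
  @lebesgue_outer R n.

HB.instance Definition _ (R : realType) (n : nat) :=
  isMeasure.Build _ 'rV[R]_n R (@leb R n)
    (@caratheodory_measure0 _ _ (@lebesgue_outer R n))
    (@caratheodory_measure_ge0 _ _ (@lebesgue_outer R n))
    (@caratheodory_measure_sigma_additive _ _ (@lebesgue_outer R n)).

Section john.
Context {R : realType} {n : nat}.
Implicit Types (D : set 'rV[R]_n) (gamma : R -> 'rV[R]_n).

Definition polygon_length gamma (a b : R) (s : seq R) : R :=
  \sum_(0 <= i < size s)
    enorm (gamma (nth b (a :: s) i.+1) - gamma (nth b (a :: s) i)).

Definition curve_length gamma (a b : R) : \bar R :=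
  ereal_sup [set (polygon_length gamma a b s)%:E | s in itv_partition a b].

(* In particular such a curve is rectifiable, of length l. *)
Definition arc_length_parametrized gamma (l : R) :=
  {within `[0, l], continuous gamma} /\
  forall t, 0 <= t <= l -> curve_length gamma 0 t = t%:E.

Definition domain D := open D /\ connected D.

Definition john_domain (c : R) D :=
  [/\ domain D, D != setT & forall x1 x2, D x1 -> D x2 ->
    exists l gamma,
      [/\ 0 <= l, arc_length_parametrized gamma l,
          gamma 0 = x1, gamma l = x2 &
          forall t, 0 <= t <= l ->
            D (gamma t) /\ Num.min t (l - t) / c <= delta D (gamma t)]].

End john.

Section potential.
Context {R : realType} {n : nat}.
Implicit Types (D : set 'rV[R]_n) (u : 'rV[R]_n -> R).

Local Open Scope ereal_scope.

(* At y = x the integrand is 0 instead of f(x)/0; a point is negligible. *)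
Definition riesz_potential (alpha : R) (f : 'rV[R]_n -> \bar R) x : \bar R :=
  \int[leb]_y (f y * ((enorm (x - y) `^ (n%:R - alpha))^-1)%:E).

(* u is a total function, of which only the values on D matter. *)
Definition in_Lr (r : R) D u := u \_ D \in Lfun leb r%:E.

Definition lebesgue_point u x :=
  (leb (eball x r))^-1 * \int[leb]_(y in eball x r) `|u y - u x|%:E
    @[r --> (0%R : R)^'+] --> 0.

Definition frac_grad (tau s p : R) D u y : \bar R :=
  (\int[leb]_(z in eball y (tau * delta D y))
     (`|u y - u z| `^ p / enorm (y - z) `^ (n%:R + s * p))%:E) `^ p^-1.

End potential.

(* Main.v *)
Require Import Defs.
From HB Require Import structures.
From mathcomp Require Import all_boot all_order all_algebra.
From mathcomp Require Import all_classical all_reals all_analysis.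
From mathcomp Require Import measurable_realfun ring lra.

Set Implicit Arguments.
Unset Strict Implicit.
Unset Printing Implicit Defensive.
Import Order.TTheory GRing.Theory Num.Theory.
Import numFieldNormedType.Exports.

Local Open Scope classical_set_scope.
Local Open Scope ring_scope.

(* Let gamma be a John curve from x to a far point of D, let t_k = T q^k with
   q < 1 close to 1, and let Q_k be a cube of side comparable to t_k near
   gamma(t_k). The John condition makes tau dist(y, boundary D) exceed |y - z|
   for y in Q_k and z in Q_(k+1), so with u_k the mean of u over Q_k a direct
   averaging over Q_(k+1) gives |u(y) - u_(k+1)| <= C t_k^s g(y) on Q_k, hence
   |u_k - u_(k+1)| <= C t_k^(s-n) int_(Q_k) g. Since |x - y| <= 2 t_k on Q_k and
   s < n, summing over k yields the Riesz potential. The means u_k tend to u(x)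
   at small scales (Lebesgue point), while at large scales they are small
   because u is in L^r with r finite; the constants do not depend on the curve,
   so no limit curve escaping to infinity is needed. *)

(* Monotonicity survives without measurability because the integral of a
   nonnegative function is a supremum over the simple functions below it; this
   is what makes it unnecessary to prove that the fractional gradient is
   measurable. *)
Lemma le_integral_unmeasurable d (T : measurableType d) (R : realType)
    (mu : {measure set T -> \bar R}) (D E : set T) (f g : T -> \bar R) :
    D `<=` E -> (forall x, D x -> 0 <= f x)%E -> (forall x, E x -> 0 <= g x)%E ->
    (forall x, D x -> f x <= g x)%E ->
  (\int[mu]_(x in D) f x <= \int[mu]_(x in E) g x)%E.
Proof.
move=> DE f0 g0 fg; rewrite !ge0_integralE//; apply: ereal_sup_le => _ [h hf <-].
exists h => // x; apply: (le_trans (hf x)); rewrite !patchE.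
case: ifPn => [/set_mem Dx|_]; first by rewrite mem_set ?fg//; exact: DE.
by case: ifPn => // /set_mem; exact: g0.
Qed.

(** * Lebesgue measure of boxes and measurability of cubes *)

(** The outer measure sums over countable sets of boxes; enumerating them makes theorems on series
    applicable. Idle indices receive the degenerate box at 0, of volume 0 because [0 < n]. *)
Lemma box_cover_seq (R : realType) n (A : set 'rV[R]_n)
    (S : set ('rV[R]_n * 'rV[R]_n)) : (0 < n)%N -> box_cover A S ->
  exists g : nat -> 'rV[R]_n * 'rV[R]_n, A `<=` \bigcup_k box (g k) /\
    (\sum_(k <oo) box_volume (g k) <= \esum_(ab in S) box_volume ab)%E.
Proof.
move=> n0 [/countable_injP[f finj] AS].
pose g k := xget (0, 0) [set ab | S ab /\ f ab = k].
have gf ab : S ab -> g (f ab) = ab.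
  move=> Sab; rewrite /g; case: xgetP => [y _ [Sy]|/(_ ab)]; last by case.
  by apply: finj; exact: mem_set.
have vol0 : box_volume (0 : 'rV[R]_n, 0 : 'rV[R]_n) = 0%E.
  rewrite /box_volume (bigD1 (Ordinal n0))//= subrr maxxx mul0r.
  by [].
exists g; split.
  by move=> x /AS[ab Sab abx]; exists (f ab) => //; rewrite gf.
rewrite nneseries_esumT; last by move=> k; exact: box_volume_ge0.
have -> : (\esum_(ab in S) box_volume ab =
           \esum_(k in f @` S) box_volume (g k))%E.
  rewrite esum_image//; apply: eq_esum => ab Sab; by rewrite gf.
rewrite [leRHS]esum_mkcond; apply: le_esum => k _.
case: ifPn => // /negP; rewrite inE /= => kS.
rewrite /g; case: xgetP => [y _ [Sy fy]|_]; last by rewrite vol0.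
by exfalso; apply: kS; exists y.
Qed.

Lemma lebesgue_measure_itv_oc (R : realType) (a b : R) :
  lebesgue_measure `]a, b]%classic = (Num.max 0 (b - a))%:E.
Proof.
rewrite lebesgue_measure_itv/= lte_fin; case: ltP => ab.
  by rewrite -EFinB; congr EFin; apply/esym/max_idPr; rewrite subr_ge0 ltW.
by congr EFin; apply/esym/max_idPl; rewrite subr_le0.
Qed.

(* The weights [w] carry the slices already fixed: integrating the covering
   inequality over one coordinate at a time reduces to dimension one. *)
Lemma weighted_cover_ge (R : realType) (h : R) (al : nat -> R) (m : nat)
    (a b : nat -> nat -> R) (w : nat -> R) : 0 < h -> (forall k, 0 <= w k) ->
    (forall x : nat -> R, (forall i, (i < m)%N -> al i < x i <= al i + h) ->
      (1 <= \sum_(k <oo) (w k * \prod_(i < m) \1_(`]a k i, b k i]) (x i))%:E)%E) ->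
  ((h ^+ m)%:E <=
    \sum_(k <oo) (w k * \prod_(i < m) Num.max 0 (b k i - a k i))%:E)%E.
Proof.
move=> h0; elim: m w => [|m IH] w w0 cov.
  apply: le_trans (cov al _) _ => //.
  by apply: lee_nneseries => k *; rewrite ?lee_fin !big_ord0 ?mulr1//.
pose P k := \prod_(i < m) Num.max 0 (b k i - a k i).
have P0 k : 0 <= P k by apply: prodr_ge0 => i _; rewrite le_max lexx.
pose E := `]al m, al m + h]%classic : set R.
pose f k t : \bar R := ((w k * P k)%:E * (\1_(`]a k m, b k m]) t)%:E)%E.
have f0 k t : (0 <= f k t)%E by rewrite mule_ge0// lee_fin mulr_ge0.
have slice t : E t -> ((h ^+ m)%:E <= \sum_(k <oo) f k t)%E.
  move=> Et.
  have w'0 k : 0 <= w k * \1_(`]a k m, b k m]) t by rewrite mulr_ge0.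
  apply: le_trans (IH (fun k => w k * \1_(`]a k m, b k m]) t) w'0 _) _; last first.
    apply: lee_nneseries => k *; first by rewrite lee_fin mulr_ge0//; exact: P0.
    by rewrite /f -EFinM lee_fin -/(P k) mulrAC.
  move=> x xal.
  pose x' i := if i == m then t else x i.
  apply: le_trans (cov x' _) _.
    move=> i; rewrite ltnS leq_eqVlt /x'; case: eqVneq => [->|im] //= im'.
    exact: xal.
  apply: lee_nneseries => k *.
    by rewrite lee_fin mulr_ge0 ?prodr_ge0.
  rewrite lee_fin big_ord_recr/= {2}/x' eqxx mulrCA mulrC.
  rewrite [leRHS]mulrAC -mulrA; rewrite mulrA.
  rewrite (eq_bigr (fun i : 'I_m => \1_`]a k i, b k i] (x i)))//.
    by rewrite mulrAC.
  by move=> i _; rewrite /x' ltn_eqF.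
have mE : measurable E by exact: measurable_itv.
have mf k : measurable_fun E (f k).
  apply: measurable_funeM; apply/measurable_EFinP.
  exact: measurable_funTS.
have -> : (h ^+ m.+1)%:E = (\int[lebesgue_measure]_(t in E) (h ^+ m)%:E)%E.
  rewrite integral_cst//= /E lebesgue_measure_itv_oc addrAC subrr add0r.
  by rewrite (max_idPr (ltW h0)) -EFinM exprSr.
(* Integrating the slice bound over the last coordinate gives a factor [h] on the left and, term by
   term on the right, at most the length of []a k m, b k m]]. *)
apply: (@le_trans _ _ (\int[lebesgue_measure]_(t in E) \sum_(k <oo) f k t)%E).
  apply: le_integral_unmeasurable => // x Ex; first by rewrite lee_fin exprn_ge0 ?ltW.
  exact: nneseries_ge0.
rewrite integral_nneseries//; apply: lee_nneseries => k *.
  by apply: integral_ge0.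
rewrite big_ord_recr/= -/(P k) mulrA EFinM /f.
have m1 : measurable_fun E (fun t => (\1_(`]a k m, b k m]%classic) t : R)%:E).
  by apply/measurable_EFinP; exact: measurable_funTS.
rewrite ge0_integralZl//; last by rewrite lee_fin mulr_ge0.
rewrite lee_wpmul2l ?lee_fin ?mulr_ge0//.
rewrite integral_indic// -lebesgue_measure_itv_oc le_measure// ?inE//.
exact: measurableI.
Qed.

(** This is additivity of length when []a, b]] is cut at [c], empty pieces counting 0; it makes box
    volumes additive under a cut by a coordinate hyperplane. *)
Lemma max0_cut (R : realType) (a b c : R) :
  Num.max 0 (Num.min b c - a) + Num.max 0 (b - Num.max a c) = Num.max 0 (b - a).
Proof.
by case: (leP b c) => ?; case: (leP a c) => ?; rewrite /Num.max;
  do ![case: ltP => ?]; lra.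
Qed.

Section lebesgue_boxes.
Context {R : realType} {n : nat} (n_gt0 : (0 < n)%N).
Implicit Types (a b : 'rV[R]_n) (ab : 'rV[R]_n * 'rV[R]_n).

Lemma leb_box_le ab : (leb (box ab) <= box_volume ab)%E.
Proof.
apply: ereal_inf_lbound; exists [set ab]; last first.
  by rewrite esum_set1// box_volume_ge0.
by split; [exact: countable1|move=> x ?; exists ab].
Qed.

Definition cube a (h : R) : set 'rV[R]_n := box (a, a + const_mx h).

(** One box gives the upper bound. For the lower bound, the indicators of the boxes of any cover sum
    to at least 1 on the cube, which is the hypothesis of [weighted_cover_ge] with unit weights. *)
Lemma leb_cube a h : 0 < h -> leb (cube a h) = (h ^+ n)%:E.
Proof.
move=> h0; apply/eqP; rewrite eq_le; apply/andP; split.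
  apply: le_trans (leb_box_le _) _; rewrite /box_volume lee_fin/=.
  rewrite (eq_bigr (fun=> h)) ?prodr_const ?card_ord// => i _.
  by rewrite !mxE addrAC subrr add0r; apply/max_idPr/ltW.
apply: le_ereal_inf_tmp => _ [S /(box_cover_seq n_gt0)[g [Ag gS]] <-].
apply: le_trans gS.
(* Coordinates are extended by 0 to all natural indices, the format of [weighted_cover_ge]. *)
pose co (v : 'rV[R]_n) (i : nat) := if insub i is Some j then v ord0 j else 0.
have coE v (i : 'I_n) : co v i = v ord0 i by rewrite /co valK.
pose A k i := co (g k).1 i. pose B k i := co (g k).2 i.
apply: le_trans
  (@weighted_cover_ge R h (co a) n A B (fun=> 1) h0 (fun=> ler01) _) _; last first.
  apply: lee_nneseries => k *; rewrite ?lee_fin mul1r.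
    by apply: prodr_ge0 => *; rewrite le_max lexx.
  by under eq_bigr do rewrite /A /B !coE.
move=> x xa.
have /Ag[k _ gk] : cube a h (\row_i x i).
  move=> i; rewrite !mxE/= -coE; exact: xa.
have F0 j : (0 <= (1 * \prod_(i < n) \1_(`]A j i, B j i]) (x i))%:E)%E.
  by rewrite lee_fin mul1r prodr_ge0.
rewrite (@nneseriesD1 _ _ k)//; rewrite (le_trans _ (leeDl _ _))//; last exact: nneseries_ge0.
rewrite mul1r lee_fin big1// => i _.
rewrite indicE mem_set//= in_itv/=.
by have := gk i; rewrite mxE /A /B !coE.
Qed.

(** Caratheodory's criterion: the hyperplane cuts each box of a cover of the test set into two
    half-open boxes [L ab] and [U ab] whose volumes add up, so covering both parts costs no more
    than covering the whole. *)
Lemma measurable_halfspace (j : 'I_n) (c : R) :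
  measurable [set x : 'rV[R]_n | x ord0 j <= c].
Proof.
apply: (@le_caratheodory_measurable R _ (@lebesgue_outer R n)) => X.
set H := [set x | _].
apply: le_ereal_inf_tmp => _ [S /(box_cover_seq n_gt0)[g [Ag gS]] <-].
apply: le_trans gS.
pose L ab := (ab.1, \row_i (if i == j then Num.min (ab.2 ord0 i) c
                            else ab.2 ord0 i) : 'rV[R]_n).
pose U ab := (\row_i (if i == j then Num.max (ab.1 ord0 i) c
                      else ab.1 ord0 i) : 'rV[R]_n, ab.2).
have boxL ab : box ab `&` H `<=` box (L ab).
  move=> x [abx]; rewrite /H/= => xj i; rewrite mxE/=.
  have /andP[ax xb] := abx i; rewrite ax/=.
  by case: eqVneq => // ij; rewrite le_min xb/= ij.
have boxU ab : box ab `&` ~` H `<=` box (U ab).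
  move=> x [abx]; rewrite /H/= => /negP; rewrite -ltNge => xj i; rewrite mxE/=.
  have /andP[ax xb] := abx i; rewrite xb/= andbT.
  by case: eqVneq => // ij; rewrite gt_max ax/= ij.
have volLU ab : (box_volume (L ab) + box_volume (U ab) = box_volume ab)%E.
  rewrite /box_volume -EFinD; congr EFin.
  have split_j (f : 'I_n -> R) :
      \prod_i f i = f j * \prod_(i | i != j) f i by rewrite (bigD1 j).
  rewrite !split_j /= !mxE !eqxx.
  rewrite [X in _ * X + _](eq_bigr (fun i => Num.max 0 (ab.2 ord0 i - ab.1 ord0 i)));
    last by move=> i /negbTE ij; rewrite mxE ij.
  rewrite [X in _ + _ * X](eq_bigr (fun i => Num.max 0 (ab.2 ord0 i - ab.1 ord0 i)));
    last by move=> i /negbTE ij; rewrite mxE ij.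
  rewrite -mulrDl; congr (_ * _).
  exact: max0_cut.
have cut (V : set 'rV[R]_n) W : V `<=` \bigcup_k box (W k) ->
    (lebesgue_outer V <= \sum_(k <oo) box_volume (W k))%E.
  move=> VW; apply: le_trans (le_lebesgue_outer VW) _.
  apply: le_trans (lebesgue_outer_sigma_subadditive _) _.
  apply: lee_nneseries => k *; first exact: lebesgue_outer_ge0.
  exact: leb_box_le.
have -> : (\sum_(k <oo) box_volume (g k) = \sum_(k <oo) box_volume (L (g k)) +
    \sum_(k <oo) box_volume (U (g k)))%E.
  rewrite -nneseriesD//; try by move=> *; exact: box_volume_ge0.
  by apply: eq_eseriesr => k _; rewrite volLU.
apply: leeD; apply: cut => x [/Ag[k _ gk] Hx]; exists k => //.
  exact: boxL.
exact: boxU.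
Qed.

Lemma measurable_cube a h : measurable (cube a h).
Proof.
have -> : cube a h = \bigcap_(i in [set: 'I_n])
    ([set x | x ord0 i <= a ord0 i + h] `\` [set x | x ord0 i <= a ord0 i]).
  apply/seteqP; split => x /= cx i; have := cx i; rewrite !mxE/=.
    by move=> /andP[ax xb] _; split=> //; apply/negP; rewrite -ltNge.
  by move=> /(_ Logic.I)[-> /negP]; rewrite -ltNge => ->.
apply: fin_bigcap_measurable => // i _.
by apply: measurableD; exact: measurable_halfspace.
Qed.

End lebesgue_boxes.

(** * The Euclidean norm *)

Section euclidean_norm.
Context {R : realType} {n : nat}.
Implicit Types x y z a : 'rV[R]_n.

Lemma enorm_ge0 x : 0 <= enorm x.
Proof. exact: sqrtr_ge0. Qed.

Lemma enorm_sqr x : enorm x ^+ 2 = \sum_(i < n) x ord0 i ^+ 2.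
Proof. by rewrite sqr_sqrtr// sumr_ge0// => i _; rewrite sqr_ge0. Qed.

Lemma coord_le_enorm x i : `|x ord0 i| <= enorm x.
Proof.
rewrite -(@ler_pXn2r _ 2)// ?nnegrE ?enorm_ge0// enorm_sqr real_normK ?num_real//.
by rewrite (bigD1 i)//= lerDl sumr_ge0// => k _; rewrite sqr_ge0.
Qed.

Lemma enorm_eq0 x : enorm x = 0 -> x = 0.
Proof.
move=> x0; apply/rowP => i; rewrite mxE; apply/eqP; rewrite -normr_le0 -x0.
exact: coord_le_enorm.
Qed.

Lemma enormN x : enorm (- x) = enorm x.
Proof. by congr Num.sqrt; apply: eq_bigr => i _; rewrite mxE sqrrN. Qed.

Lemma enormB x y : enorm (x - y) = enorm (y - x).
Proof. by rewrite -enormN opprB. Qed.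

Lemma cauchy_schwarz_sum x y :
  \sum_(i < n) x ord0 i * y ord0 i <= enorm x * enorm y.
Proof.
have [x0|x0] := eqVneq (enorm x) 0.
  rewrite x0 mul0r big1// => i _.
  by have := enorm_eq0 x0 => ->; rewrite mxE mul0r.
have [y0|y0] := eqVneq (enorm y) 0.
  rewrite y0 mulr0 big1// => i _.
  by have := enorm_eq0 y0 => ->; rewrite mxE mulr0.
have xy0 : 0 < enorm x * enorm y.
  by rewrite mulr_gt0// lt_def ?x0 ?y0 enorm_ge0.
set X := enorm x; set Y := enorm y; set P := \sum_(i < n) _.
(* This sum of squares expands to [2 * X * Y * (X * Y - P)], and [X * Y > 0]. *)
have : 0 <= \sum_(i < n) (Y * x ord0 i - X * y ord0 i) ^+ 2.
  by apply: sumr_ge0 => i _; rewrite sqr_ge0.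
have -> : \sum_(i < n) (Y * x ord0 i - X * y ord0 i) ^+ 2 =
    Y ^+ 2 * (\sum_(i < n) x ord0 i ^+ 2) +
    X ^+ 2 * (\sum_(i < n) y ord0 i ^+ 2) - (X * Y * P) *+ 2.
  rewrite /P !mulr_sumr -sumrMnl -big_split -sumrB/=.
  by apply: eq_bigr => i _; ring.
rewrite -!enorm_sqr -/X -/Y => h.
rewrite -(ler_pM2l xy0) -/X -/Y; nra.
Qed.

Lemma ler_enormD x y : enorm (x + y) <= enorm x + enorm y.
Proof.
rewrite -(@ler_pXn2r _ 2)// ?nnegrE ?addr_ge0 ?enorm_ge0//.
rewrite sqrrD !enorm_sqr.
have -> : \sum_(i < n) (x + y) ord0 i ^+ 2 = \sum_(i < n) x ord0 i ^+ 2 +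
    (\sum_(i < n) x ord0 i * y ord0 i) *+ 2 + \sum_(i < n) y ord0 i ^+ 2.
  by rewrite -sumrMnl -!big_split/=; apply: eq_bigr => i _; rewrite mxE sqrrD.
by rewrite lerD2r lerD2l lerMn2r/= cauchy_schwarz_sum.
Qed.

Lemma ler_enormB y x z : enorm (x - z) <= enorm (x - y) + enorm (y - z).
Proof. by rewrite (le_trans _ (ler_enormD _ _))// addrA subrK. Qed.

Lemma enorm_le_coord x (h : R) : (forall i, `|x ord0 i| <= h) ->
  0 <= h -> enorm x <= n%:R * h.
Proof.
move=> xh h0; rewrite -(@ler_pXn2r _ 2)// ?nnegrE ?enorm_ge0 ?mulr_ge0//.
rewrite enorm_sqr (@le_trans _ _ (\sum_(i < n) h ^+ 2))//.
  apply: ler_sum => i _; rewrite -real_normK ?num_real//.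
  by rewrite ler_pXn2r ?nnegrE.
rewrite sumr_const card_ord exprMn -(mulr_natl (h ^+ 2)) ler_wpM2r ?sqr_ge0//.
by rewrite -natrX ler_nat; case: (n) => // m; rewrite -mulnn leq_pmulr.
Qed.

Lemma mx_norm_le_enorm x : `|x| <= enorm x.
Proof.
rewrite /Num.norm/= mx_normrE; apply/bigmax_leP; split; first exact: enorm_ge0.
by move=> [i j] _ /=; rewrite ord1; exact: coord_le_enorm.
Qed.

(* The cube must avoid [x] because the Riesz kernel takes the junk value 0 at
   its pole; with [z] at one of two opposite corners this is always possible. *)
Lemma cube_nearby (z x : 'rV[R]_n) (h : R) : (0 < n)%N -> 0 < h ->
  exists a, ~ cube a h x /\ forall y, cube a h y -> enorm (z - y) <= n%:R * h.
Proof.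
move=> n0 h0; pose i0 := Ordinal n0.
pose a := if x ord0 i0 <= z ord0 i0 then z else z - const_mx h.
exists a; rewrite /a; case: ifPn => [|/negbTE] xz; split.
- by move=> /(_ i0); rewrite /= !mxE ltNge xz.
- move=> y yc; apply: enorm_le_coord (ltW h0) => i.
  by have := yc i; rewrite /= !mxE ler_norml => /andP[? ?]; apply/andP; split; lra.
- by move=> /(_ i0); rewrite /= !mxE subrK xz andbF.
- move=> y yc; apply: enorm_le_coord (ltW h0) => i.
  by have := yc i; rewrite /= !mxE ler_norml => /andP[? ?]; apply/andP; split; lra.
Qed.

End euclidean_norm.

(** * Distance to the boundary *)

Section boundary_distance.
Context {R : realType} {n : nat}.
Implicit Types (x y z : 'rV[R]_n) (A D : set 'rV[R]_n).

Lemma dist_to_le x A a : A a -> dist_to x A <= enorm (x - a).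
Proof.
move=> Aa; apply: inf_lbound; last by exists a.
by exists 0 => _ [b _ <-]; exact: enorm_ge0.
Qed.

Lemma dist_to_lip x y A : dist_to x A <= dist_to y A + enorm (x - y).
Proof.
have [->|/set0P A0] := eqVneq A set0.
  (* The infimum of the empty set is 0 by convention. *)
  by rewrite /dist_to !image_set0 inf0 add0r enorm_ge0.
rewrite -lerBlDr; apply: lb_le_inf.
  by have [a Aa] := A0; exists (enorm (y - a)); exists a.
move=> _ [a Aa <-]; rewrite lerBlDr addrC.
exact: le_trans (dist_to_le x Aa) (ler_enormB y _ _).
Qed.

(** A segment from [x] that left [D] would meet the boundary at a distance at most [enorm (x - y)],
    hence below [delta D x]. *)
Lemma eball_delta_subset D x : open D -> D x -> eball x (delta D x) `<=` D.
Proof.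
move=> oD Dx y; rewrite /eball/= => xy.
pose f (t : R) : 'rV[R]_n := x + t *: (y - x).
have cf : continuous f.
  by move=> t; apply: cvgD; [exact: cvg_cst|apply: cvgZr_tmp; exact: cvg_id].
pose I := f @` `[0, 1].
have cI : connected I.
  apply: connected_continuous_connected; first exact: segment_connected.
  exact: continuous_subspaceT.
have If w : I w -> enorm (x - w) <= enorm (x - y).
  move=> [t]; rewrite /= in_itv/= => /andP[t0 t1] <-.
  rewrite /f opprD addrA subrr sub0r enormN.
  rewrite [leRHS]enormB -[leRHS]mul1r.
  rewrite -[leLHS]ger0_norm ?enorm_ge0//.
  rewrite -(@ler_pXn2r _ 2)// ?nnegrE ?normr_ge0 ?mul1r ?enorm_ge0//.
  rewrite ger0_norm ?enorm_ge0// !enorm_sqr; apply: ler_sum => i _.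
  by rewrite mxE exprMn ler_piMl ?sqr_ge0// expr_le1.
(* Connectedness in clopen form: [I] misses the boundary, so it meets [D] and [closure D] in the
   same set. *)
have ID : I `&` D = I.
  apply: cI.
  - exists x; split=> //; exists 0 => /=; first by rewrite in_itv/= lexx ler01.
    by rewrite /f scale0r addr0.
  - by exists D.
  - exists (closure D); first exact: closed_closure.
    apply/seteqP; split=> w [Iw Dw]; split=> //; first exact: subset_closure.
    apply: contrapT => nDw.
    have Bw : boundary D w.
      by split; [exact: Dw|rewrite (interior_id D).1].
    have := lt_le_trans (le_lt_trans (If _ Iw) xy) (dist_to_le x Bw).
    by rewrite ltxx.
have : I y.
  exists 1 => /=; first by rewrite in_itv/= lexx ler01.
  by rewrite /f scale1r addrC subrK.
by rewrite -ID => -[].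
Qed.

End boundary_distance.

(** * John curves to far points *)

Section john_curves.
Context {R : realType} {n : nat}.
Implicit Types (gamma : R -> 'rV[R]_n) (D : set 'rV[R]_n).

Lemma polygon_length_rcons gamma a b b' s :
  polygon_length gamma a b' (rcons s b') =
  polygon_length gamma a b s + enorm (gamma b' - gamma (last a s)).
Proof.
have nthE j : (j <= size s)%N -> nth b' (a :: rcons s b') j = nth b (a :: s) j.
  by move=> js; rewrite -rcons_cons nth_rcons/= ltnS js; exact: set_nth_default.
rewrite /polygon_length size_rcons big_nat_recr//; congr (_ + _).
  by apply: eq_big_nat => i /andP[_ si]; rewrite !nthE// ltnW.
rewrite (nthE (size s))//= nth_rcons ltnn eqxx; congr (enorm (_ - gamma _)).
by rewrite (last_nth b).
Qed.

(** A polygon inscribed on [[0, t']] followed by the chord from [t'] to [t] is inscribed on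
    [[0, t]]; taking suprema, [t'] plus the chord is at most [t]. *)
Lemma arc_length_lipschitz gamma l : arc_length_parametrized gamma l ->
  forall t t', 0 <= t' <= t -> t <= l -> enorm (gamma t - gamma t') <= t - t'.
Proof.
move=> [_ len] t t' /andP[t'0]; rewrite le_eqVlt => /predU1P[->|t't] tl.
  rewrite !subrr.
  rewrite /enorm big1 ?sqrtr0// => i _; by rewrite mxE expr0n.
have lt : curve_length gamma 0 t = t%:E.
  by apply: len; rewrite (le_trans t'0 (ltW t't)).
have lt' : curve_length gamma 0 t' = t'%:E.
  by apply: len; rewrite t'0 (le_trans (ltW t't)).
rewrite lerBrDl -lee_fin EFinD -lt' -leeBrDr//.
apply: ge_ereal_sup => _ [s st' <-].
rewrite leeBrDr// -EFinD -lt; apply: ereal_sup_ubound.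
exists (rcons s t).
  rewrite -cats1; apply: itv_partition_cat st' _; exact: itv_partition1.
congr EFin; rewrite (polygon_length_rcons _ _ t').
by case: st' => _ /eqP ->.
Qed.

(** Join [x] to a point at distance at least [2N] and keep the first half of the curve: there the
    minimum in the John condition is [t], and the half length is at least [N] since the curve is
    1-Lipschitz. *)
Lemma john_far_curve (c : R) D x (N : R) : 1 <= c -> john_domain c D ->
    ~ bounded_set D -> D x ->
  exists T gamma, [/\ N <= T,
    gamma 0 = x,
    forall t t', 0 <= t' <= t -> t <= T -> enorm (gamma t - gamma t') <= t - t' &
    forall t, 0 <= t <= T -> D (gamma t) /\ t / c <= delta D (gamma t)].
Proof.
move=> c1 [_ _ john] Dnb Dx.
have [y Dy Ny] : exists2 y, D y & N *+ 2 <= enorm (x - y).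
  apply: contrapT => far; apply: Dnb.
  (* [bounded_set] refers to the sup norm, which [enorm] dominates. *)
  exists (`|x| + `|N *+ 2|); split; first by rewrite num_real.
  move=> M NM y Dy /=; apply: ltW; apply: le_lt_trans NM.
  rewrite -lerBlDl (le_trans (lerB_dist _ _))// distrC.
  rewrite (le_trans (mx_norm_le_enorm _))// (le_trans _ (ler_norm _))//.
  by rewrite leNgt; apply/negP => Ny; apply: far; exists y => //; exact: ltW.
have [l [gamma [l0 arc g0 gl H]]] := john _ _ Dx Dy.
have lip := arc_length_lipschitz arc.
exists (l / 2), gamma; split => //.
- rewrite ler_pdivlMr// mulr_natr (le_trans Ny)// -g0 -gl enormB.
  by rewrite (le_trans (lip _ _ _ _))// ?subr0// lexx.
- by move=> t t' tt' tl; apply: lip => //; lra.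
- move=> t /andP[t0 tl]; have tl' : 0 <= t <= l by lra.
  have [Dt dt] := H _ tl'; split=> //.
  apply: le_trans dt; rewrite ler_wpM2r ?invr_ge0 ?(le_trans ler01)//.
  by rewrite le_min lexx/=; lra.
Qed.

End john_curves.

(* Averaged, this replaces Jensen's inequality, at the cost of a factor 2. *)
Lemma le_add_scaled_powR (R : realType) (a lam p : R) : 0 <= a -> 0 < lam ->
  1 <= p -> a <= lam + lam / lam `^ p * a `^ p.
Proof.
move=> a0 l0 p1; have l_ge0 := ltW l0.
have -> : lam / lam `^ p * a `^ p = lam * (a / lam) `^ p.
  by rewrite powRM ?invr_ge0// -[lam^-1]powR_inv1// -powRrM mulN1r powRN mulrAC mulrA.
have {1}-> : a = lam * (a / lam) by rewrite mulrCA divff ?gt_eqF// mulr1.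
rewrite -[X in _ <= X + _]mulr1 -mulrDr ler_wpM2l//.
have [ab|ab] := leP (a / lam) 1; first by rewrite (le_trans ab)// lerDl powR_ge0.
by rewrite (le_trans (le1r_powR (ltW ab) p1))// lerDr.
Qed.

(** * Geometric series of real powers *)

Lemma powR_lt1 (R : realType) (q be : R) : 0 < q < 1 -> 0 < be -> q `^ be < 1.
Proof.
move=> /andP[q0 q1] be0; rewrite /powR gt_eqF// -[ltRHS](@expR0 R) ltr_expR.
by rewrite pmulr_rlt0// ln_lt0// q0.
Qed.

Lemma geometric_powR_sum (R : realType) (T q d be : R) (K : nat) :
    0 < T -> 0 < q < 1 -> 0 < d -> 0 < be ->
  \sum_(k < K) (if d <= T * q ^+ k then (T * q ^+ k) `^ (- be) else 0) <=
  (1 - q `^ be)^-1 * d `^ (- be).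
Proof.
move=> T0 q01 d0 be0; have /andP[q0 q1] := q01.
have qb1 : q `^ be < 1 by exact: powR_lt1.
set A := (1 - q `^ be)^-1.
have A0 : 0 <= A by rewrite invr_ge0 subr_ge0 ltW.
have AE : A * q `^ be + 1 = A.
  rewrite /A; have : 1 - q `^ be != 0 by rewrite gt_eqF// subr_gt0.
  by move=> h; field.
pose f k := (T * q ^+ k) `^ (- be).
have t0 k : 0 < T * q ^+ k by rewrite mulr_gt0// exprn_gt0.
have fS k : q `^ be * f k.+1 = f k.
  rewrite /f exprSr mulrA [in X in _ * X = _]powRM ?ltW// mulrCA -powRD.
    by rewrite subrr powRr0 mulr1.
  by rewrite (gt_eqF q0) implybT.
have fle k d' : 0 < d' -> d' <= T * q ^+ k -> f k <= d' `^ (- be).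
  move=> d'0 dk; rewrite /f !powRN lef_pV2 ?posrE ?powR_gt0//.
  by apply: ge0_ler_powR => //; rewrite ?nnegrE ltW.
set S := \sum_(k < K) _.
suff [] : S <= A * d `^ (- be) /\ S <= A * (q `^ be * f K) by [].
rewrite /S {S}; elim: K => [|K [IH1 IH2]].
  by rewrite big_ord0 !mulr_ge0 ?powR_ge0.
rewrite big_ord_recr/= fS; case: ifPn => dK; last first.
  rewrite addr0; split=> //; apply: (le_trans IH1); rewrite ler_wpM2l//.
  rewrite /f !powRN lef_pV2 ?posrE ?powR_gt0//.
  by apply: ge0_ler_powR; rewrite ?nnegrE ?ltW// ltNge.
have h : \sum_(k < K) (if d <= T * q ^+ k then f k else 0) + f K <= A * f K.
  by rewrite -[in leRHS]AE mulrDl mul1r lerD2r -mulrA.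
by split=> //; apply: (le_trans h); rewrite ler_wpM2l// fle.
Qed.

(** * Averages over cubes *)

Section cube_average.
Context {R : realType} {n : nat} (n_gt0 : (0 < n)%N).
Implicit Types (u : 'rV[R]_n -> R) (a x y : 'rV[R]_n) (D : set 'rV[R]_n).

Definition avg u a (h : R) : R :=
  (h ^+ n)^-1 * fine (\int[leb]_(z in cube a h) (u z)%:E)%E.

Lemma integral_cst_cube a h (k : R) : 0 < h ->
  (\int[leb]_(z in cube a h) k%:E = (k * h ^+ n)%:E)%E.
Proof.
move=> h0; rewrite integral_cst; last exact: measurable_cube.
by rewrite EFinM; congr (_ * _)%E; exact: leb_cube.
Qed.

(** The integral of [k - u] is [h ^+ n] times [k - avg u a h]; the triangle inequality for integrals
    does the rest. *)
Lemma avg_dist u a h (k : R) : 0 < h ->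
    leb.-integrable (cube a h) (EFin \o u) ->
  ((h ^+ n * `|k - avg u a h|)%:E <= \int[leb]_(z in cube a h) `|k - u z|%:E)%E.
Proof.
move=> h0 iu; have mQ := measurable_cube n_gt0 a h.
have ik : leb.-integrable (cube a h) (EFin \o cst k).
  apply/integrableP; split; first exact/measurable_EFinP.
  by rewrite /= integral_cst_cube// ltry.
have iku : leb.-integrable (cube a h) (EFin \o (fun z => k - u z)).
  rewrite (_ : _ \o _ = (EFin \o cst k) \- (EFin \o u))%E; last by [].
  exact: integrableB.
have hn0 : 0 < h ^+ n by rewrite exprn_gt0.
have -> : h ^+ n * `|k - avg u a h| =
    `|\int[leb]_(z in cube a h) (k - u z)|.
  rewrite (RintegralB mQ ik iu).
  rewrite [X in _ = `|X - _|](congr1 fine (integral_cst_cube a k h0))/= /avg.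
  rewrite -[X in X * `|_|](gtr0_norm hn0) -normrM mulrBr mulrA divff ?gt_eqF//.
  by rewrite mul1r mulrC.
rewrite (le_trans _ (_ : (\int[leb]_(z in cube a h) `|k - u z|)%:E <= _)%E)//.
  by rewrite lee_fin le_normr_Rintegral.
rewrite /Rintegral fineK//.
have := integrable_abse iku; exact: integrable_fin_num.
Qed.

(** The scale [lam] stays free: 1 yields local integrability, a small value yields decay of
    averages, and a balancing value yields the oscillation bound. *)
Lemma integral_le_powR u a h (lam p : R) : 0 < h -> 0 < lam -> 1 <= p ->
    measurable_fun (cube a h) u -> (forall z, 0 <= u z) ->
  (\int[leb]_(z in cube a h) (u z)%:E <= (lam * h ^+ n)%:E +
    (lam / lam `^ p)%:E * \int[leb]_(z in cube a h) (u z `^ p)%:E)%E.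
Proof.
move=> h0 l0 p1 mu u0; have mQ := measurable_cube n_gt0 a h.
have c0 : 0 <= lam / lam `^ p by rewrite divr_ge0 ?powR_ge0 ?ltW.
have mup : measurable_fun (cube a h) (fun z => (u z `^ p)%:E).
  apply/measurable_EFinP; exact: (measurableT_comp (measurable_powR p)).
rewrite -(integral_cst_cube a lam h0).
rewrite -ge0_integralZl_EFin//; last by move=> z _; rewrite lee_fin powR_ge0.
rewrite -ge0_integralD; first last.
- exact: measurable_funeM.
- by move=> z _; rewrite mule_ge0// lee_fin ?powR_ge0.
- exact: measurable_cst.
- by move=> z _; rewrite lee_fin ltW.
- exact: mQ.
apply: le_integral_unmeasurable => [|z _|z _|z _].
- by [].
- by rewrite lee_fin.
- by rewrite adde_ge0 ?mule_ge0// lee_fin ?powR_ge0// ltW.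
- by rewrite -EFinM -EFinD lee_fin; exact: le_add_scaled_powR.
Qed.

Lemma measurable_Lr u D a h (r : R) : in_Lr r D u -> cube a h `<=` D ->
  measurable_fun (cube a h) u.
Proof.
move=> uL QD; have mQ := measurable_cube n_gt0 a h.
have mw : measurable_fun setT (u \_ D) by have /andP[/set_mem] := uL.
have := measurable_funTS mw (D := cube a h).
apply: eq_measurable_fun => z /set_mem /QD zD.
by rewrite patchE mem_set.
Qed.

(** [M] is the integral over all of [D], so one bound serves every cube. *)
Lemma integral_powR_Lr u D (r : R) : 1 <= r -> in_Lr r D u ->
  exists M : R, 0 <= M /\ forall a h, cube a h `<=` D ->
    (\int[leb]_(z in cube a h) (`|u z| `^ r)%:E <= M%:E)%E.
Proof.
move=> r1 uL; have iw := Lfun_integrable r1 uL.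
have w0 : (0 <= \int[leb]_z (`|(u \_ D) z| `^ r)%:E)%E.
  by apply: integral_ge0 => z _; rewrite lee_fin powR_ge0.
exists (fine (\int[leb]_z (`|(u \_ D) z| `^ r)%:E)%E); split; first exact: fine_ge0.
move=> a h QD; rewrite fineK; last exact: integrable_fin_num iw.
apply: le_integral_unmeasurable => // z; rewrite ?lee_fin ?powR_ge0//.
by move=> /QD zD; rewrite patchE mem_set.
Qed.

Lemma integrable_Lr u D a h (r : R) : 0 < h -> 1 <= r -> in_Lr r D u ->
  cube a h `<=` D -> leb.-integrable (cube a h) (EFin \o u).
Proof.
move=> h0 r1 uL QD; have mu := measurable_Lr uL QD.
have [M [M0 HM]] := integral_powR_Lr r1 uL.
apply/integrableP; split; first exact/measurable_EFinP.
under eq_integral do rewrite /= .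
have mnu : measurable_fun (cube a h) (fun z => `|u z|).
  exact: measurableT_comp.
apply: le_lt_trans (integral_le_powR h0 ltr01 r1 mnu _) _ => //.
rewrite powR1 divr1 mul1e; apply: lte_add_pinfty; first by rewrite ltry.
exact: le_lt_trans (HM _ _ QD) (ltry _).
Qed.

Lemma avg_decay u D (r e : R) : 1 <= r -> in_Lr r D u -> 0 < e ->
  exists N : R, forall a h, 0 < h -> N <= h -> cube a h `<=` D ->
    `|avg u a h| <= e *+ 2.
Proof.
move=> r1 uL e0; have [M [M0 HM]] := integral_powR_Lr r1 uL.
exists (1 + M / e `^ r) => a h h0 Nh QD.
have iu := integrable_Lr h0 r1 uL QD.
have mnu : measurable_fun (cube a h) (fun z => `|u z|).
  by apply: measurableT_comp => //; exact: measurable_Lr uL QD.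
have hn0 : 0 < h ^+ n by rewrite exprn_gt0.
have er0 : 0 < e `^ r by rewrite powR_gt0.
rewrite -(ler_pM2l hn0) -lee_fin.
have := avg_dist 0 h0 iu; rewrite sub0r normrN => /le_trans; apply.
under eq_integral do rewrite sub0r normrN.
apply: le_trans (integral_le_powR h0 e0 r1 mnu _) _ => //.
apply: (@le_trans _ _ ((e * h ^+ n)%:E + (e / e `^ r)%:E * M%:E)%E).
  by rewrite leeD2l// lee_wpmul2l ?HM// lee_fin divr_ge0 ?ltW.
have h1 : 1 <= h by apply: le_trans Nh; rewrite lerDl divr_ge0// ltW.
have Mh : M / e `^ r <= h ^+ n.
  rewrite (le_trans _ (_ : h <= _))//; last exact: ler_eXnr.
  by apply: le_trans Nh; rewrite lerDr.
rewrite -EFinM -EFinD lee_fin -mulr_natr [e / _ * M]mulrAC -mulrA.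
have := ler_wpM2l (ltW e0) Mh; nra.
Qed.

Lemma lebesgue_point_avg u D x (r kap e : R) : 1 <= r -> in_Lr r D u ->
    0 < kap -> 0 < e -> lebesgue_point u x ->
  exists rho : R, 0 < rho /\ forall a t, 0 < t < rho ->
    cube a (kap * t) `<=` D -> cube a (kap * t) `<=` eball x (t *+ 2) ->
    `|u x - avg u a (kap * t)| <= e.
Proof.
move=> r1 uL k0 e0 lx.
(* The ball of radius [2t] lies in a cube of side [4t]; [e'] absorbs the ratio of that cube's
   measure to the measure of the cube of side [kap * t]. *)
pose e' := e * (kap / 4) ^+ n.
have e'0 : 0 < e' by rewrite mulr_gt0// exprn_gt0// divr_gt0.
have /lx : nbhs (0%E : \bar R) [set z | z < e'%:E]%E.
  by apply: open_nbhs_nbhs; split; [exact: open_ereal_lt_ereal|rewrite /= lte_fin].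
rewrite /= /at_right/= => -[rho /= rho0 H].
exists (rho / 2); split; first by rewrite divr_gt0.
move=> a t /andP[t0 trho] QD QB.
have h0 : 0 < kap * t by rewrite mulr_gt0.
have iu := integrable_Lr h0 r1 uL QD.
have hn0 : 0 < (kap * t) ^+ n by rewrite exprn_gt0.
have t20 : 0 < t *+ 2 by rewrite pmulrn_lgt0.
have := H (t *+ 2); rewrite /ball/= sub0r normrN gtr0_norm// => /(_ _ t20).
move=> /(_ _)/ltW; have -> : t *+ 2 < rho by rewrite mulr2n; lra.
move=> /(_ isT).
set I := (\int[_]_(_ in _) _)%E => HI.
rewrite -(ler_pM2l hn0) -lee_fin.
apply: le_trans (avg_dist (u x) h0 iu) _.
apply: (@le_trans _ _ I).
  apply: le_integral_unmeasurable => // z _; rewrite ?lee_fin//.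
  by rewrite distrC.
have I0 : (0 <= I)%E by apply: integral_ge0 => z _; rewrite lee_fin.
have lB : (leb (eball x (t *+ 2)) <= ((t * 4) ^+ n)%:E)%E.
  rewrite -(leb_cube n_gt0 (x - const_mx (t *+ 2))) ?mulr_gt0//.
  apply: le_lebesgue_outer => z /= xz i; rewrite !mxE/=.
  have := le_lt_trans (coord_le_enorm (x - z) i) xz; rewrite !mxE ltr_norml.
  rewrite -mulr_natr => /andP[? ?]; apply/andP; split; lra.
have V0 : 0 < (t * 4) ^+ n by rewrite exprn_gt0// mulr_gt0.
have {}HI : (((t * 4) ^+ n)^-1%:E * I <= e'%:E)%E.
  apply: le_trans HI; rewrite lee_wpmul2r//.
  have -> : ((t * 4) ^+ n)^-1%:E = (((t * 4) ^+ n)%:E^-1)%E by rewrite inver gt_eqF.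
  by rewrite lee_pV2 ?inE ?lee_fin ?(ltW V0) ?lebesgue_outer_ge0.
have -> : (kap * t) ^+ n * e = (t * 4) ^+ n * e'.
  rewrite /e' mulrCA -exprMn [RHS]mulrC; congr (_ ^+ n * _).
  by field.
have -> : I = (((t * 4) ^+ n)%:E * (((t * 4) ^+ n)^-1%:E * I))%E.
  by rewrite muleA -EFinM divff ?mul1e ?gt_eqF.
rewrite [leRHS]EFinM.
by rewrite lee_wpmul2l// lee_fin ltW.
Qed.

End cube_average.

(** * Oscillation bounded by the fractional gradient *)

Section oscillation.
Context {R : realType} {n : nat} (n_gt0 : (0 < n)%N).
Implicit Types (u : 'rV[R]_n -> R) (a x y : 'rV[R]_n) (D : set 'rV[R]_n).

Lemma frac_grad_ge0 (tau s p : R) D u y : (0 <= frac_grad tau s p D u y)%E.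
Proof. exact: poweR_ge0. Qed.

Lemma avg_oscillation u D y a (tau s p h L : R) : 0 < h -> 0 < L -> 0 < s ->
    1 <= p -> measurable_fun (cube a h) u ->
    leb.-integrable (cube a h) (EFin \o u) ->
    cube a h `<=` eball y (tau * delta D y) ->
    (forall z, cube a h z -> enorm (y - z) <= L) ->
  (`|u y - avg u a h|%:E <=
    (((L / h) `^ (n%:R / p) * L `^ s) *+ 2)%:E * frac_grad tau s p D u y)%E.
Proof.
move=> h0 L0 s0 p1 mu iu QB QL; have mQ := measurable_cube n_gt0 a h.
have p0 : 0 < p by apply: lt_le_trans p1.
pose m := n%:R + s * p.
have m0 : 0 < m by rewrite addr_gt0// ?ltr0n// mulr_gt0.
have Lm0 : 0 < L `^ m by rewrite powR_gt0.
have hn0 : 0 < h ^+ n by rewrite exprn_gt0.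
rewrite /frac_grad; set I := integral _ _ _.
have I0 : (0 <= I)%E.
  by apply: integral_ge0 => z _; rewrite lee_fin divr_ge0 ?powR_ge0.
have mv : measurable_fun (cube a h) (fun z => `|u y - u z|).
  have mB : measurable_fun (cube a h) (fun z => u y - u z).
    by apply: (measurable_funB _ mu); exact: measurable_cst.
  exact: (measurableT_comp _ mB).
have mvp : measurable_fun (cube a h) (fun z => (`|u y - u z| `^ p)%:E).
  by apply/measurable_EFinP; exact: (measurableT_comp (measurable_powR p)).
have JI : (\int[leb]_(z in cube a h) (`|u y - u z| `^ p)%:E <= (L `^ m)%:E * I)%E.
  have -> : (\int[leb]_(z in cube a h) (`|u y - u z| `^ p)%:E =
      (L `^ m)%:E * \int[leb]_(z in cube a h)
        ((L `^ m)^-1%:E * (`|u y - u z| `^ p)%:E))%E.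
    have Lm1 : 0 <= (L `^ m)^-1 by rewrite invr_ge0 ltW.
    rewrite (ge0_integralZl_EFin leb mQ _ mvp Lm1).
      by rewrite muleA -EFinM divff ?gt_eqF// mul1e.
    by move=> z _; rewrite lee_fin powR_ge0.
  apply: lee_wpmul2l; first by rewrite lee_fin ltW.
  apply: le_integral_unmeasurable => [|z _|z _|z Qz].
  - exact: QB.
  - by rewrite -EFinM lee_fin mulr_ge0 ?invr_ge0 ?powR_ge0.
  - by rewrite lee_fin divr_ge0 ?powR_ge0.
  (* At [z = y] the numerator vanishes, so the value given to the kernel at its pole is harmless. *)
  rewrite -EFinM lee_fin mulrC; have [->|yz] := eqVneq y z.
    by rewrite subrr normr0 powR0 ?gt_eqF// !mul0r.
  have yz0 : 0 < enorm (y - z).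
    rewrite lt_def enorm_ge0 andbT; apply: contra yz => /eqP/enorm_eq0/eqP.
    by rewrite subr_eq0.
  rewrite ler_wpM2l ?powR_ge0// lef_pV2 ?posrE ?powR_gt0//.
  by apply: ge0_ler_powR; last exact: QL; rewrite ?nnegrE ltW.
have L1 : 0 < (L / h) `^ (n%:R / p) by rewrite powR_gt0// divr_gt0.
have L2 : 0 < L `^ s by rewrite powR_gt0.
case: I I0 JI => [r| |] //; last first.
  move=> _ _; rewrite poweRyr ?invr_neq0 ?gt_eqF// gt0_muley ?leey//.
  by rewrite lte_fin pmulrn_lgt0// mulr_gt0.
rewrite lee_fin => r0 JI.
rewrite poweR_EFin -EFinM lee_fin.
have bound lam : 0 < lam -> L `^ m * r <= lam `^ p * h ^+ n ->
    `|u y - avg u a h| <= lam *+ 2.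
  move=> l0 lr; have lp0 : 0 < lam `^ p by rewrite powR_gt0.
  rewrite -(ler_pM2l hn0) -lee_fin.
  apply: le_trans (avg_dist n_gt0 (u y) h0 iu) _.
  apply: le_trans (integral_le_powR n_gt0 h0 l0 p1 mv _) _ => //.
  apply: (@le_trans _ _ ((lam * h ^+ n)%:E +
      (lam / lam `^ p)%:E * ((L `^ m)%:E * r%:E))%E).
    by rewrite leeD2l// lee_wpmul2l// lee_fin divr_ge0 ?ltW.
  rewrite -!EFinM -EFinD lee_fin.
  have : lam / lam `^ p * (L `^ m * r) <= lam / lam `^ p * (lam `^ p * h ^+ n).
    by rewrite ler_wpM2l// divr_ge0 ?ltW.
  by rewrite [leRHS]mulrA divfK ?gt_eqF// -mulr_natr; set W := _ * (_ * r); nra.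
set l0 := _ *+ 2 * _.
(* [lam0] solves [L]^ m * r = lam [^ p * h ^+ n]. It vanishes when [r = 0], whereas [bound] wants a
   positive scale, hence the extra [e / 2]. *)
apply/ler_addgt0Pr => e e0.
pose lam0 := (L / h) `^ (n%:R / p) * L `^ s * r `^ p^-1.
have lam0_ge0 : 0 <= lam0 by rewrite !mulr_ge0 ?powR_ge0.
have -> : l0 + e = (lam0 + e / 2) *+ 2.
  rewrite /l0 -/lam0 mulrnDl -(mulr_natr (e / 2)) divfK//; congr (_ + _).
  by rewrite mulrnAl.
apply: bound; first by rewrite ltr_wpDl// divr_gt0.
apply: (@le_trans _ _ (lam0 `^ p * h ^+ n)); last first.
  have e20 : 0 <= e / 2 by rewrite divr_ge0 ?ltW.
  apply: ler_wpM2r (ltW hn0) _ _ _; apply: ge0_ler_powR; first exact: ltW.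
  - exact: lam0_ge0.
  - exact: addr_ge0.
  - by rewrite lerDl.
rewrite /lam0 (powRM p (mulr_ge0 (powR_ge0 _ _) (powR_ge0 _ _)) (powR_ge0 _ _)).
rewrite (powRM p (powR_ge0 _ _) (powR_ge0 _ _)).
rewrite -!powRrM mulVf ?gt_eqF// powRr1//.
have Lh0 : 0 <= L / h by rewrite divr_ge0 ?ltW.
rewrite divfK ?gt_eqF// (powR_mulrn n Lh0) /m powRD ?(gt_eqF L0) ?implybT//.
rewrite (powR_mulrn n (ltW L0)) expr_div_n.
by rewrite le_eqVlt; apply/orP; left; apply/eqP; field; rewrite expf_neq0 ?gt_eqF.
Qed.

End oscillation.

(** * Summation along the chain of cubes *)

Section chain.
Context {R : realType} {n : nat} (n_gt0 : (0 < n)%N).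
Implicit Types (u : 'rV[R]_n -> R) (x y : 'rV[R]_n) (D : set 'rV[R]_n).

(* No bounded overlap of the cubes is needed: the factors [t k `^ (s - n)] of the
   cubes that contain [y] form a geometric series, dominated by its term of
   smallest scale, which is at least [enorm (x - y) / 2]. *)
Lemma chain_sum u D x (g : 'rV[R]_n -> \bar R) (a : nat -> 'rV[R]_n)
    (T q kap C1 s : R) (K : nat) :
    0 < T -> 0 < q < 1 -> 0 < kap -> 0 < C1 -> 0 < s < 1 ->
    (forall y, 0 <= g y)%E ->
    let t k := T * q ^+ k in let Q k := cube (a k) (kap * t k) in
    let F k := avg u (a k) (kap * t k) in
    (forall k, leb.-integrable (Q k) (EFin \o u)) ->
    (forall k y, Q k y -> [/\ D y, y != x & enorm (x - y) <= t k *+ 2]) ->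
    (forall k y, Q k y ->
      (`|u y - F k.+1|%:E <= (C1 * t k `^ s)%:E * g y)%E) ->
  ((\sum_(k < K) `|F k - F k.+1|)%:E <=
    (C1 / kap ^+ n * 2 `^ (n%:R - s) / (1 - q `^ (n%:R - s)))%:E *
    \int[leb]_(y in D) (g y * ((enorm (x - y) `^ (n%:R - s))^-1)%:E))%E.
Proof.
move=> T0 q01 k0 C10 /andP[s0 s1] g0 t Q F iu QD osc.
have /andP[q0 q1] := q01.
have be0 : 0 < n%:R - s by rewrite subr_gt0 (lt_le_trans s1)// ler1n.
set be := n%:R - s in be0 *; set C := _ / (1 - _).
have qb1 : q `^ be < 1 by exact: powR_lt1.
have C0 : 0 < C.
  by rewrite !(divr_gt0, mulr_gt0, exprn_gt0, powR_gt0)// subr_gt0.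
have CE : C = C1 / kap ^+ n * 2 `^ be / (1 - q `^ be) by [].
clearbody C.
have t0 k : 0 < t k by rewrite mulr_gt0// exprn_gt0.
have h0 k : 0 < kap * t k by rewrite mulr_gt0.
have hn0 k : 0 < (kap * t k) ^+ n by rewrite exprn_gt0.
have mQ k : measurable (Q k) by exact: measurable_cube.
have FQ k : (((kap * t k) ^+ n * `|F k.+1 - F k|)%:E <=
    \int[leb]_(y in Q k) `|F k.+1 - u y|%:E)%E.
  exact: (avg_dist n_gt0 (F k.+1) (h0 k) (iu k)).
have tE k : t k = T * q ^+ k by [].
clearbody F Q t.
(* Sum and integral are exchanged for these measurable functions; [g] enters only afterwards, by
   pointwise comparison. *)
pose v k y : \bar R := (((kap * t k) ^+ n * C)^-1%:E * `|F k.+1 - u y|%:E)%E.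
have v0 k y : (0 <= v k y)%E by rewrite mule_ge0// lee_fin invr_ge0 ltW// mulr_gt0.
have mu k : measurable_fun (Q k) u.
  by apply/measurable_EFinP; exact: measurable_int (iu k).
have mFu k : measurable_fun (Q k) (fun y => `|F k.+1 - u y|%:E).
  have mB : measurable_fun (Q k) (fun y => F k.+1 - u y).
    by apply: (measurable_funB _ (mu k)); exact: measurable_cst.
  by apply/measurable_EFinP; exact: (measurableT_comp _ mB).
pose f k := v k \_ (Q k).
have f0 k y : (0 <= f k y)%E by exact: erestrict_ge0.
have mf k : measurable_fun setT (f k).
  by apply/(measurable_restrictT _ _).1 => //; exact: measurable_funeM.
have step k : ((C^-1 * `|F k - F k.+1|)%:E <= \int[leb]_y f k y)%E.
  have hC0 : 0 <= ((kap * t k) ^+ n * C)^-1 by rewrite invr_ge0 ltW// mulr_gt0.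
  rewrite -integral_mkcond (ge0_integralZl_EFin leb (mQ k) _ (mFu k) hC0)//.
  have c0 : (0 <= ((kap * t k) ^+ n * C)^-1%:E)%E by rewrite lee_fin.
  apply: le_trans (lee_wpmul2l c0 (FQ k)).
  rewrite -EFinM lee_fin (distrC (F k)).
  rewrite invfM mulrACA mulVf ?mul1r// gt_eqF//.
suff key : (\sum_(k < K) (C^-1 * `|F k - F k.+1|)%:E <=
    \int[leb]_(y in D) (g y * ((enorm (x - y) `^ be)^-1)%:E))%E.
  have C_ge0 : (0 <= C%:E)%E by rewrite lee_fin ltW.
  apply: le_trans (lee_wpmul2l C_ge0 key).
  by rewrite sumEFin -mulr_sumr -EFinM mulrA divff ?mul1r// gt_eqF.
apply: le_trans (lee_sum _ (fun (k : 'I_K) _ => step k)) _.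
rewrite -(@ge0_integral_sum _ _ _ leb _ measurableT _ (fun (k : 'I_K) => f k))//.
rewrite [leRHS]integral_mkcond.
apply: le_integral_unmeasurable => // y _.
- exact: sume_ge0.
- apply: erestrict_ge0 => z _; rewrite mule_ge0// lee_fin invr_ge0 powR_ge0//.
(* Outside [D] and at the pole [x] no cube contributes, so the left side is 0. *)
have [yD|yD] := pselect (D y /\ y != x); last first.
  rewrite big1; last first.
    move=> k _; rewrite /f patchE; case: ifPn => // /set_mem /QD[Dy yx _].
    by exfalso; apply: yD.
  by apply: erestrict_ge0 => z _; rewrite mule_ge0// lee_fin invr_ge0 powR_ge0.
have [Dy yx] := yD; rewrite [leRHS]patchE mem_set//.
have d0 : 0 < enorm (x - y).
  rewrite lt_def enorm_ge0 andbT; apply: contra yx => /eqP/enorm_eq0/eqP.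
  by rewrite subr_eq0 eq_sym.
pose d := enorm (x - y) / 2.
have d20 : 0 < d by rewrite divr_gt0.
pose B := C1 / kap ^+ n / C.
have B0 : 0 <= B by rewrite !divr_ge0 ?ltW// exprn_gt0.
(* Membership of [y] in [Q k] forces [d <= t k]. The factor [B] equals [(1 - q]^ be) / 2 [^ be],
   which cancels the constant of the geometric sum and the halving in [d]. *)
pose w k := B * (if d <= t k then t k `^ (- be) else 0).
have w0 k : 0 <= w k by rewrite mulr_ge0//; case: ifP => // _; exact: powR_ge0.
have fw k : (f k y <= (w k)%:E * g y)%E.
  rewrite /f patchE; case: ifPn => [/set_mem Qy|_]; last by rewrite mule_ge0 ?lee_fin.
  have [_ _ xy] := QD _ _ Qy.
  rewrite /w ifT; last by rewrite /d ler_pdivrMr// mulr_natr.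
  have -> : B * t k `^ (- be) =
      ((kap * t k) ^+ n * C)^-1 * (C1 * t k `^ s).
    rewrite /B /be opprB powRD ?(gt_eqF (t0 k)) ?implybT//.
    rewrite powRN (powR_mulrn n (ltW (t0 k))).
    rewrite exprMn; field.
    by rewrite !expf_neq0 ?gt_eqF.
  rewrite EFinM -muleA /v lee_wpmul2l//.
    by rewrite lee_fin invr_ge0 ltW// mulr_gt0.
  by rewrite distrC; exact: osc.
apply: le_trans (lee_sum _ (fun (k : 'I_K) _ => fw k)) _.
rewrite -ge0_sume_distrl; last by move=> k _; rewrite lee_fin.
rewrite muleC lee_wpmul2l// sumEFin lee_fin -mulr_sumr.
under eq_bigr do rewrite tE.
apply: le_trans (ler_wpM2l B0 (geometric_powR_sum K T0 q01 d20 be0)) _.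
rewrite -powRN.
have -> : d `^ (- be) = enorm (x - y) `^ (- be) * 2 `^ be.
  rewrite /d powRM ?invr_ge0 ?enorm_ge0//; congr (_ * _).
  by rewrite -powR_inv1// -powRrM mulrNN mul1r.
rewrite /B CE.
rewrite le_eqVlt; apply/orP; left; apply/eqP.
field.
by rewrite subr_eq0 (gt_eqF qb1) expf_neq0 !gt_eqF ?powR_gt0.
Qed.

End chain.

(** * Choice of constants and construction of the chain *)

Theorem theorem2p4 (R : realType) (n : nat) (tau c s p : R) :
  (2 <= n)%N -> 0 < tau < 1 -> 0 < s < 1 -> 1 <= c -> 1 <= p ->
  exists C : R, 0 < C /\
    forall D : set 'rV[R]_n, john_domain c D -> ~ bounded_set D ->
    forall u : 'rV[R]_n -> R, (exists r : R, 1 <= r /\ in_Lr r D u) ->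
    forall x : 'rV[R]_n, D x -> lebesgue_point u x ->
      let g := frac_grad tau s p D u in
      (`|u x|%:E <=
        C%:E * \int[leb]_(y in D)
          (g y * ((enorm (x - y) `^ (n%:R - s))^-1)%:E))%E /\
      (C%:E * \int[leb]_(y in D)
          (g y * ((enorm (x - y) `^ (n%:R - s))^-1)%:E) =
        C%:E * riesz_potential s (g \_ D) x)%E.
Proof.
move=> n2 /andP[tau0 tau1] s01 c1 p1.
have n0 : (0 < n)%N by apply: leq_trans n2.
have nR0 : 0 < n%:R :> R by rewrite ltr0n.
have c0 : 0 < c by apply: lt_le_trans c1.
have /andP[s0 s1] := s01.
(* With [Q k] within [eta * t k] of [gamma (t k)], the John condition gives
   [tau * delta >= 8 * eta * t k] at [gamma (t k)] and 7 instead of 8 on [Q k], more than the 3 that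
   bounds distances between consecutive cubes. *)
pose eta := tau / (8 * c).
have eta0 : 0 < eta by rewrite divr_gt0// mulr_gt0.
have etac : eta * c = tau / 8 by rewrite /eta; field; rewrite gt_eqF.
have eta8 : eta < 1 / 8.
  by rewrite /eta ltr_pdivrMr ?mulr_gt0//; nra.
clearbody eta.
(* The bound [n * h] of [cube_nearby] becomes [eta * t k]. *)
pose kap := eta / n%:R.
have kap0 : 0 < kap by rewrite divr_gt0.
have nkap : n%:R * kap = eta by rewrite mulrCA divff ?mulr1// gt_eqF.
(* Consecutive centres [gamma (t k)] are then at most [eta * t k] apart. *)
pose q := 1 - eta.
have q01 : 0 < q < 1 by rewrite /q; lra.
have /andP[q0 q1] := q01.
pose be := n%:R - s.
have be0 : 0 < be by rewrite subr_gt0 (lt_le_trans s1)// ler1n.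
have qb1 : q `^ be < 1 by exact: powR_lt1.
(* In [avg_oscillation], [L = 3 * eta * t k] and [h = kap * q * t k] have ratio [3 * n / q]; also
   [L <= t k]. *)
pose C1 := ((3 * n%:R / q) `^ (n%:R / p)) *+ 2.
have C10 : 0 < C1 by rewrite pmulrn_lgt0// powR_gt0// divr_gt0// mulr_gt0.
pose C := C1 / kap ^+ n * 2 `^ be / (1 - q `^ be).
have C0 : 0 < C.
  by rewrite !(divr_gt0, mulr_gt0, exprn_gt0, powR_gt0)// subr_gt0.
exists C; split=> // D john Dnb u [r [r1 uL]] x Dx lx g.
have oD : open D by case: john => [[]].
split; last first.
  congr (_ * _)%E; rewrite /riesz_potential integral_mkcond.
  apply: eq_integral => y _; rewrite !patchE.
  by case: ifPn => // _; rewrite mul0e.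
apply/lee_addgt0Pr => e e0.
have e30 : 0 < e / 3 by rewrite divr_gt0.
have e60 : 0 < e / 6 by rewrite divr_gt0.
have [N decay] := avg_decay n0 r1 uL e60.
have [rho [rho0 near_x]] := lebesgue_point_avg n0 r1 uL kap0 e30 lx.
(* [T >= N / kap] makes the largest cube, of side [kap * T], big enough for [decay]. *)
have [T [gamma [NT g0 lip inside]]] :=
  john_far_curve (Num.max 1 (N / kap)) c1 john Dnb Dx.
move: NT; rewrite ge_max => /andP[T1 NT].
have T0 : 0 < T by apply: lt_le_trans T1.
pose t k := T * q ^+ k.
have t0 k : 0 < t k by rewrite mulr_gt0// exprn_gt0.
have tT k : t k <= T by rewrite ler_piMr ?exprn_ile1 ?(ltW q0, ltW q1, ltW T0).
have tS k : t k.+1 = q * t k by rewrite /t exprSr; ring.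
have h0 k : 0 < kap * t k by rewrite mulr_gt0.
have [a Ha] : {a : nat -> 'rV[R]_n & forall k, ~ cube (a k) (kap * t k) x /\
    forall y, cube (a k) (kap * t k) y -> enorm (gamma (t k) - y) <= eta * t k}.
  apply: (@choice _ _ (fun k b => ~ cube b (kap * t k) x /\
    forall y, cube b (kap * t k) y -> enorm (gamma (t k) - y) <= eta * t k)) => k.
  have [b [bx Hb]] := cube_nearby (gamma (t k)) x n0 (h0 k).
  by exists b; split=> // y /Hb; rewrite mulrA nkap.
pose Q k := cube (a k) (kap * t k).
have Qgamma k y : Q k y -> enorm (gamma (t k) - y) <= eta * t k by apply: (Ha k).2.
have tk k : 0 <= t k <= T by rewrite tT ltW.
have deltaQ k y : Q k y -> 7 * (eta * t k) <= tau * delta D y.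
  move=> Qy; have [_ dt] := inside _ (tk k).
  have := dist_to_lip (gamma (t k)) y (boundary D); rewrite -/(delta D _) -/(delta D _).
  have := Qgamma _ _ Qy; move: dt; rewrite ler_pdivrMr//.
  set dg := delta D (gamma _); set dy := delta D y; set ey := enorm _.
  move=> dt yg dgy.
  have h1 : 8 * (eta * t k) <= tau * dg.
    rewrite -(ler_pM2r c0) -(mulrA tau).
    have -> : 8 * (eta * t k) * c = tau * t k.
      by transitivity (8 * (eta * c) * t k); [ring|rewrite etac; field].
    exact: ler_wpM2l (ltW tau0) _ _ dt.
  have h2 : tau * dg <= tau * (dy + ey) by rewrite ler_wpM2l// ltW.
  have h3 : tau * ey <= eta * t k.
    by rewrite -[leRHS]mul1r ler_pM ?enorm_ge0 ?(ltW tau0) ?(ltW tau1).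
  lra.
have QD k y : Q k y -> D y.
  move=> Qy; have [Dg dt] := inside _ (tk k).
  apply: (eball_delta_subset oD Dg); rewrite /eball/=.
  apply: le_lt_trans (Qgamma _ _ Qy) _; apply: lt_le_trans dt.
  rewrite ltr_pdivlMr// mulrAC etac.
  by have := t0 k; nra.
have Qx k y : Q k y -> enorm (x - y) < t k *+ 2.
  move=> Qy; apply: le_lt_trans (ler_enormB (gamma (t k)) _ _) _.
  have : enorm (x - gamma (t k)) <= t k.
    rewrite enormB -g0 (le_trans (lip _ _ _ _))// ?subr0//.
    by rewrite lexx ltW.
  have := Qgamma _ _ Qy; rewrite -mulr_natr; have := t0 k; nra.
have QQ k y z : Q k y -> Q k.+1 z -> enorm (y - z) <= 3 * (eta * t k).
  move=> Qy Qz; apply: le_trans (ler_enormB (gamma (t k)) _ _) _.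
  have := ler_enormB (gamma (t k.+1)) (gamma (t k)) z.
  have := Qgamma _ _ Qy; have := Qgamma _ _ Qz; rewrite (enormB y) tS.
  have : enorm (gamma (t k) - gamma (q * t k)) <= t k - q * t k.
    by rewrite -tS; apply: lip => //; rewrite ltW//= tS ler_piMl ?ltW.
  by rewrite /q; have := t0 k; nra.
have iu k : leb.-integrable (Q k) (EFin \o u).
  by apply: (integrable_Lr n0 (h0 k) r1 uL) => y; exact: QD.
have mu k : measurable_fun (Q k) u.
  by apply: (measurable_Lr n0 uL) => y; exact: QD.
pose F k := avg u (a k) (kap * t k).
have osc k y : Q k y -> (`|u y - F k.+1|%:E <= (C1 * t k `^ s)%:E * g y)%E.
  move=> Qy.
  have et0 : 0 < eta * t k by rewrite mulr_gt0 ?eta0 ?t0.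
  have L0 : 0 < 3 * (eta * t k) by rewrite mulr_gt0.
  have QB : Q k.+1 `<=` eball y (tau * delta D y).
    move=> z Qz; rewrite /eball/=; apply: le_lt_trans (QQ _ _ _ Qy Qz) _.
    by apply: lt_le_trans (deltaQ _ _ Qy); rewrite (ltr_pM2r et0) ltr_nat.
  apply: le_trans (avg_oscillation n0 (h0 k.+1) L0 s0 p1 (mu k.+1) (iu k.+1) QB
    (fun z => QQ k y z Qy)) _.
  rewrite lee_wpmul2r ?frac_grad_ge0// lee_fin /C1 (mulrnAl (_ `^ _)) lerMn2r/=.
  have -> : 3 * (eta * t k) / (kap * t k.+1) = 3 * n%:R / q.
    by rewrite tS -nkap; field; rewrite !gt_eqF.
  rewrite ler_wpM2l ?powR_ge0//; apply: ge0_ler_powR; rewrite ?nnegrE ?ltW//.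
  by have := t0 k; nra.
(* The chain is finite but its length depends on [e]; the constant of [chain_sum] does not depend on
   [K]. *)
have [K tK] : exists K, t K < rho.
  have : q ^+ k @[k --> \oo] --> (0 : R).
    by apply: cvg_expr; rewrite ger0_norm // ltW.
  move=> /cvgrPdist_lt/(_ (rho / T)); rewrite divr_gt0// => /(_ isT)[K _ HK].
  exists K; have := HK K (leqnn K).
  rewrite /= sub0r normrN ger0_norm ?exprn_ge0 ?(ltW q0)// /t.
  by rewrite ltr_pdivlMr// mulrC.
(* The cubes were chosen to avoid [x], where the kernel takes the default value 0. *)
have Qnx k y : Q k y -> [/\ D y, y != x & enorm (x - y) <= t k *+ 2].
  move=> Qy; split; [exact: QD Qy| |exact/ltW/Qx].
  by apply/eqP => yx; apply: (Ha k).1; rewrite -yx.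
have chain := chain_sum n0 K T0 q01 kap0 C10 s01
  (frac_grad_ge0 tau s p D u) iu Qnx osc.
have FK : `|u x - F K| <= e / 3.
  apply: near_x; first by rewrite t0.
    by move=> y; exact: QD.
  by move=> y; exact: Qx.
have F0 : `|F 0%N| <= e / 3.
  have -> : e / 3 = (e / 6) *+ 2 by rewrite -mulr_natr; field.
  apply: decay => //; last by move=> y; exact: QD.
  by rewrite /t expr0 mulr1 mulrC -ler_pdivrMr.
have tel : `|F 0%N - F K| <= \sum_(k < K) `|F k - F k.+1|.
  apply: le_trans (ler_norm_sum _ _ _).
  rewrite (_ : \sum_(k < K) _ = F 0%N - F K)//.
  elim: K {tK chain FK} => [|j IH]; first by rewrite big_ord0 subrr.
  by rewrite big_ord_recr/= IH addrA subrK.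
have ux : `|u x| <= \sum_(k < K) `|F k - F k.+1| + e.
  have -> : u x = (u x - F K) - (F 0%N - F K) + F 0%N by ring.
  rewrite (le_trans (ler_normD _ _))// (le_trans (lerD (ler_normB _ _) (lexx _)))//.
  lra.
apply: (@le_trans _ _ ((\sum_(k < K) `|F k - F k.+1|)%:E + e%:E)%E).
  by rewrite -EFinD lee_fin.
exact: leeD2r.
Qed.
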